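(* For every positive integer $d$ there is a constant $C_d$ such that every $(d+1)$-uniform hypergraph $\mathcal{H}$ on $n\ge 1$ vertices which is linearly $d$-embeddable satisfies $\chi(\mathcal{H})\leq C_d\, n^{\frac{\lceil d/2\rceil-1}{d}}$.
   Context: A hypergraph is $k$-uniform if all hyperedges have size $k$; its vertex set is assumed to be the union of its hyperedges. For a hypergraph $\mathcal{H}$, $\mathsf{K}(\mathcal{H})$ is the simplicial complex consisting of all subsets of hyperedges of $\mathcal{H}$. $\mathcal{H}$ is linearly $d$-embeddable if there is a map of the vertices into $\mathbb{R}^d$ whose piecewise-linear extension to the geometric realization of $\mathsf{K}(\mathcal{H})$ (each face mapped to the convex hull of the images of its vertices) is an embedding. A (weak) coloring of $\mathcal{H}$ with $m$ colors is a map $c:V(\mathcal{H})\to[m]$ such that no hyperedge is contained in a single color class; $\chi(\mathcal{H})$ is the minimum number of colors. *)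

(* Defs.v *)
From HB Require Import structures.
From mathcomp Require Import all_boot all_order all_algebra.
From mathcomp Require Import reals exp.
Set Implicit Arguments. Unset Strict Implicit. Unset Printing Implicit Defensive.
Import Order.TTheory GRing.Theory Num.Theory.
Local Open Scope ring_scope.

Definition uniform (T : finType) (k : nat) (E : {set {set T}}) : Prop :=
  forall e, e \in E -> #|e| = k.

Definition colorable (T : finType) (E : {set {set T}}) (m : nat) : bool :=
  [exists c : {ffun T -> 'I_m},
     [forall e in E, [exists x in e, [exists y in e, c x != c y]]]].

(* chromatic number: the least m admitting a coloring with m colours.
   Any coloring can be taken with at most #|T| colours, so we search
   m <= #|T|; if no coloring exists at all (only possible when some
   hyperedge has size <= 1) the value #|T|.+1 is a dummy. *)
Definition chi (T : finType) (E : {set {set T}}) : nat :=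
  \big[minn/#|T|.+1]_(m < #|T|.+1 | colorable E m) m.

(* Points of the (standard) geometric realization of K(H): barycentric
   coordinate functions lam : T -> R, nonnegative, summing to 1, supported
   in some face, i.e. in a subset of some hyperedge. *)
Definition in_realization (R : realType) (T : finType) (E : {set {set T}})
    (lam : T -> R) : Prop :=
  (forall v, 0 <= lam v) /\ (\sum_(v : T) lam v = 1) /\
  (exists2 e, e \in E & forall v, v \notin e -> lam v = 0).

Definition lin_ext (R : realType) (d : nat) (T : finType)
    (f : T -> 'rV[R]_d) (lam : T -> R) : 'rV[R]_d :=
  \sum_(v : T) lam v *: f v.

(* linear d-embeddability: the PL extension is injective on the geometric
   realization (which is compact, so injective continuous = embedding). *)
Definition linearly_embeddable (R : realType) (d : nat) (T : finType)
    (E : {set {set T}}) : Prop :=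
  exists f : T -> 'rV[R]_d,
    forall lam mu, in_realization E lam -> in_realization E mu ->
      lin_ext f lam = lin_ext f mu -> forall v, lam v = mu v.

(* Main.v *)
(* Fix a generic direction [u].  Write [u = \sum_(v in e) lam_v f(v)] with
   [\sum lam_v = 0] for each simplex [e].  Moving from the relative interior
   of the face [{lam < 0}] in direction [u] one enters [e], so by embeddedness
   this face determines [e]; so does [{lam > 0}], using [- u].  The smaller of
   the two has at most [k = ceil (d / 2)] vertices, hence any [s] vertices span
   at most [2 s ^ k] edges.  If [k = 1] the hypergraph is degenerate and
   greedily colorable.  If [k > 1], a random coloring with about
   [4 s ^ ((k - 1) / d)] colors is proper outside a set of at most [s / 2]
   vertices, and one recurses on that set with fresh colors. *)

Require Import Defs.
From HB Require Import structures.
From mathcomp Require Import all_boot all_order all_algebra.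
From mathcomp Require Import reals exp.
From mathcomp Require Import zify lra.
Import Order.TTheory GRing.Theory Num.Theory.
Local Open Scope ring_scope.

Set Implicit Arguments.
Unset Strict Implicit.
Unset Printing Implicit Defensive.

(** * Counting the simplices of a linear embedding *)

Section Geometry.
Variables (R : realType) (d : nat) (T : finType).
Implicit Types (E : {set {set T}}) (e S : {set T}) (lam mu : T -> R).

Lemma lin_extD (f : T -> 'rV[R]_d) lam mu :
  lin_ext f (fun v => lam v + mu v) = lin_ext f lam + lin_ext f mu.
Proof.
rewrite /lin_ext -big_split; apply: eq_bigr => v _; by rewrite scalerDl.
Qed.

Lemma lin_extZ (f : T -> 'rV[R]_d) a lam :
  lin_ext f (fun v => a * lam v) = a *: lin_ext f lam.
Proof.
rewrite /lin_ext scaler_sumr; apply: eq_bigr => v _; by rewrite scalerA.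
Qed.

(* Two simplices that share the face [e :&: e'] and both contain a small
   segment issued from its relative interior in the same direction: the
   embedding identifies the two barycentric descriptions of that segment. *)
Lemma direction_inj E (f : T -> 'rV[R]_d) :
  (forall lam mu, in_realization E lam -> in_realization E mu ->
     lin_ext f lam = lin_ext f mu -> forall v, lam v = mu v) ->
  forall e e' lam mu, e \in E -> e' \in E -> e :&: e' != set0 ->
  (forall v, v \notin e -> lam v = 0) -> (forall v, v \notin e' -> mu v = 0) ->
  (forall v, v \notin e :&: e' -> 0 <= lam v) ->
  (forall v, v \notin e :&: e' -> 0 <= mu v) ->
  \sum_v lam v = 0 -> \sum_v mu v = 0 -> lin_ext f lam = lin_ext f mu ->
  lam =1 mu.
Proof.
move=> finj e e' lam mu eE e'E /set0Pn[w we] lam0 mu0 lamP muP slam smu fE.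
(* A weight positive exactly on the common face, so large there that [M + lam] and [M + mu] are
   nonnegative. Both have total mass [s], so dividing by [s] gives two points of the realization
   with the same image. *)
pose M v := if v \in e :&: e' then 1 + `|lam v| + `|mu v| else 0.
have M0 v : 0 <= M v by rewrite /M; case: ifP => // _; rewrite !addr_ge0.
have sM : 0 < \sum_v M v.
  rewrite (bigD1 w) //= ltr_pwDl ?sumr_ge0 //.
  by rewrite /M we -addrA ltr_pwDl // addr_ge0.
set s := \sum_v M v in sM.
have key nu (c : {set T}) : c \in E -> e :&: e' \subset c ->
    (forall v, v \notin c -> nu v = 0) ->
    (forall v, v \notin e :&: e' -> 0 <= nu v) -> \sum_v nu v = 0 ->
    (forall v, v \in e :&: e' -> 0 <= M v + nu v) ->
    in_realization E (fun v => s^-1 * (M v + nu v)).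
  move=> cE sc nu0 nuP snu MP; split=> [v|]; last split.
  - rewrite mulr_ge0 ?invr_ge0 ?(ltW sM) //.
    by have [/MP//|vn] := boolP (v \in e :&: e'); rewrite addr_ge0 ?nuP.
  - by rewrite -mulr_sumr big_split /= snu addr0 mulVf ?gt_eqF.
  exists c => // v vc; rewrite nu0 // addr0 /M ifF ?mulr0 //.
  by apply: contraNF vc => /(subsetP sc).
have nP (a : R) : 0 <= `|a| + a.
  by have := ler_norm (- a); rewrite normrN -subr_ge0 opprK.
have lamR := key lam e eE (subsetIl _ _) lam0 lamP slam.
have muR := key mu e' e'E (subsetIr _ _) mu0 muP smu.
have {}lamR : in_realization E (fun v => s^-1 * (M v + lam v)).
  apply: lamR => x xe; rewrite /M xe addrAC.
  by rewrite addr_ge0 // -addrA addr_ge0 // nP.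
have {}muR : in_realization E (fun v => s^-1 * (M v + mu v)).
  by apply: muR => x xe; rewrite /M xe -addrA addr_ge0 ?nP // addr_ge0.
move=> v; apply: (addrI (M v)); apply: (mulfI (invr_neq0 (lt0r_neq0 sM)))=> /=.
by apply: (finj _ _ lamR muR _ v); rewrite !lin_extZ !lin_extD fE.
Qed.

(* By Cramer's rule the barycentric coordinates of a point of the moment curve,
   viewed as a direction, are nonzero polynomials in the parameter; a parameter
   that is a root of none of them gives a generic direction. *)
Lemma simplex_direction (f : T -> 'rV[R]_d) e : (0 < d)%N -> #|e| = d.+1 ->
  (forall lam, (forall v, v \notin e -> lam v = 0) -> \sum_v lam v = 0 ->
     lin_ext f lam = 0 -> forall v, lam v = 0) ->
  exists p : T -> {poly R}, [/\ forall v, (p v != 0) = (v \in e),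
    forall t, \sum_v (p v).[t] = 0 &
    forall t, lin_ext f (fun v => (p v).[t]) = \row_(j < d) t ^+ j].
Proof.
move=> d0 ce find.
pose g (i : 'I_d.+1) : T := enum_val (cast_ord (esym ce) i).
have ge i : g i \in e by apply: enum_valP.
have ginj : injective g by move=> i j /enum_val_inj /cast_ord_inj.
have gsurj v : v \in e -> exists i, v = g i.
  move=> ve; exists (cast_ord ce (enum_rank_in ve v)).
  by rewrite /g cast_ordK enum_rankK_in.
have sumg (V : nmodType) (F : T -> V) : (forall v, v \notin e -> F v = 0) ->
    \sum_v F v = \sum_i F (g i).
  move=> F0; rewrite (bigID (mem e)) /= [X in _ + X]big1 ?addr0 //.
  rewrite -(big_imset _ (h := g) (A := predT)) /=; last by move=> ? ? _ _ /ginj.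
  apply: eq_bigl => v; apply/idP/imsetP => [/gsurj[i ->]|[i _ ->]//].
  by exists i.
(* The rows are homogeneous coordinates of the vertices, so a left-kernel vector is an affine
   dependence. *)
pose A : 'M[R]_(1 + d) := \matrix_i row_mx 1 (f (g i)).
have z0 : ord0 = lshift d ord0 :> 'I_(1 + d) by apply: val_inj.
have A0 i : A i ord0 = 1.
  by rewrite mxE z0 row_mxEl mxE eqxx.
have A1 i j : A i (rshift 1 j) = f (g i) 0 j.
  by rewrite mxE row_mxEr.
have Au : A \in unitmx.
  rewrite -row_free_unit -kermx_eq0; apply/rowV0P => c /sub_kermxP cA.
  pose lam v := \sum_(i | g i == v) c 0 i.
  have lamg i : lam (g i) = c 0 i.
    by rewrite /lam (big_pred1 i) // => j; rewrite /= (inj_eq ginj).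
  have lam0 v : v \notin e -> lam v = 0.
    move=> ve; rewrite /lam big_pred0 // => i.
    by apply: contraNF ve => /eqP <-.
  apply/rowP => i; rewrite -lamg mxE; apply: find => //.
    rewrite sumg //; move/rowP/(_ ord0): cA; rewrite !mxE => cA.
    rewrite -[RHS]cA; apply: eq_bigr => j _.
    by rewrite A0 mulr1 lamg.
  rewrite /lin_ext sumg => [|v /lam0->]; last by rewrite scale0r.
  apply/rowP => j; move/rowP/(_ (rshift 1 j)): cA; rewrite !mxE => cA.
  rewrite -[RHS]cA summxE; apply: eq_bigr => k _.
  by rewrite A1 mxE lamg.
pose B := invmx A.
(* Entry [i] of the row (0, 1, t, ..., t^(d-1)) times [B]; the leading 0 is what makes these
   coordinates sum to zero. *)
pose q (i : 'I_(1 + d)) : {poly R} := \sum_(j < d) B (rshift 1 j) i *: 'X^j.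
have qE t i : (q i).[t] = (row_mx 0 (\row_(j < d) t ^+ j) *m B) 0 i.
  rewrite horner_sum mxE big_split_ord /= [X in X + _]big1 ?add0r => [|j _].
    by apply: eq_bigr => j _; rewrite row_mxEr !mxE hornerZ hornerXn mulrC.
  by rewrite row_mxEl mxE mul0r.
(* Otherwise column [i] of [B] vanishes below its top entry, so column [i] of [A *m B] is constant,
   unlike that of an identity matrix with [1 + d > 1] rows. *)
have q0 i : q i != 0.
  apply/eqP => qi0.
  have B0 j : B (rshift 1 j) i = 0.
    move/(congr1 (fun p : {poly R} => p`_j)): qi0; rewrite coef0 coef_sum.
    rewrite (bigD1 j) //= coefZ coefXn eqxx mulr1 big1 ?addr0 // => k kj.
    by rewrite coefZ coefXn eq_sym (inj_eq val_inj) (negPf kj) mulr0.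
  have AB w : (w == i)%:R = B ord0 i.
    have := congr1 (fun C : 'M_(1 + d) => C w i) (mulmxV Au); rewrite /= !mxE => <-.
    rewrite big_split_ord /= [X in _ + X]big1 ?addr0 => [|j _].
      by rewrite zmodp.big_ord1 -z0 A0 mul1r.
    by rewrite B0 mulr0.
  have [w wi] : exists w : 'I_(1 + d), w != i.
    by exists (lift i (Ordinal d0)); rewrite eq_sym neq_lift.
  have := AB w; rewrite -(AB i) eqxx (negPf wi) => /eqP.
  by rewrite eq_sym oner_eq0.
pose p v := \sum_(i | g i == v) q i.
have pg i : p (g i) = q i.
  by rewrite /p (big_pred1 i) // => j; rewrite /= (inj_eq ginj).
have p0 v : v \notin e -> p v = 0.
  move=> ve; rewrite /p big_pred0 // => i.
  by apply: contraNF ve => /eqP <-.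
have qA t : \row_i (q i).[t] *m A = row_mx 0 (\row_(j < d) t ^+ j).
  rewrite (_ : \row_i _ = row_mx 0 (\row_(j < d) t ^+ j) *m B) ?mulmxKV //.
  by apply/rowP => i; rewrite mxE qE.
exists p; split=> [v|t|t].
- have [/gsurj[i ->]|/p0->] := boolP (v \in e); last by rewrite eqxx.
  by rewrite pg q0.
- rewrite sumg => [|v /p0->]; last by rewrite horner0.
  have /rowP/(_ ord0) := qA t.
  rewrite [in RHS]z0 row_mxEl !mxE => h; rewrite -[RHS]h.
  by apply: eq_bigr => i _; rewrite mxE A0 mulr1 pg.
rewrite /lin_ext sumg => [|v /p0->]; last by rewrite horner0 scale0r.
apply/rowP => j; have /rowP/(_ (rshift 1 j)) := qA t.
rewrite row_mxEr => <-; rewrite summxE !mxE.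
by apply: eq_bigr => i _; rewrite A1 !mxE pg.
Qed.

Lemma poly_nonroot (p : {poly R}) : p != 0 -> exists t, p.[t] != 0.
Proof.
move=> p0; pose s : seq R := [seq n%:R | n <- iota 0 (size p)].
have us : uniq s by rewrite map_inj_uniq ?iota_uniq //;
  exact/mulrIn/oner_neq0.
have [/(max_poly_roots p0)/(_ us)|/allPn[t _ tp]] := boolP (all (root p) s).
  by rewrite size_map size_iota ltnn.
by exists t.
Qed.

(** The product of all coordinate polynomials over the finitely many simplices is nonzero, so one
    parameter avoids all their roots at once. *)
Lemma generic_direction E (f : T -> 'rV[R]_d) : (0 < d)%N -> uniform d.+1 E ->
  (forall e, e \in E -> 
   forall lam, (forall v, v \notin e -> lam v = 0) -> \sum_v lam v = 0 ->
     lin_ext f lam = 0 -> forall v, lam v = 0) ->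
  exists (u : 'rV[R]_d) (lam : {set T} -> T -> R), forall e, e \in E ->
    [/\ forall v, (lam e v != 0) = (v \in e), \sum_v lam e v = 0 &
        lin_ext f (lam e) = u].
Proof.
move=> d0 uE find.
have /fin_all_exists[p pP] : forall e, exists p : T -> {poly R}, e \in E ->
   [/\ forall v, (p v != 0) = (v \in e), forall t, \sum_v (p v).[t] = 0 &
    forall t, lin_ext f (fun v => (p v).[t]) = \row_(j < d) t ^+ j].
  move=> e; have [eE|] := boolP (e \in E); last by exists (fun=> 0).
  by have [p pP] := simplex_direction d0 (uE e eE) (find e eE); exists p.
have : \prod_(e in E) \prod_(v in e) p e v != 0.
  apply/prodf_neq0 => e eE; apply/prodf_neq0 => v ve.
  by case: (pP e eE) => ->.
move/poly_nonroot => [t]; rewrite horner_prod => /prodf_neq0 tP.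
exists (\row_(j < d) t ^+ j), (fun e v => (p e v).[t]) => e eE.
have [p1 p2 p3] := pP e eE; split=> // v.
have [ve|ve] := boolP (v \in e).
  by have := tP e eE; rewrite horner_prod => /prodf_neq0/(_ v ve).
by have := p1 v; rewrite (negPf ve) => /negbFE/eqP->; rewrite horner0 eqxx.
Qed.

(** Such a set is the image of a map from ['I_k] to [S]: list its elements, then repeat one of them
    to fill the remaining places. *)
Lemma card_small_subsets S k :
  (#|[set A : {set T} | [&& A \subset S, A != set0 & #|A| <= k]]| <= #|S| ^ k)%N.
Proof.
have <- : #|ffun_on S : pred {ffun 'I_k -> T}| = (#|S| ^ k)%N.
  by rewrite card_ffun_on card_ord.
apply: leq_trans (leq_imset_card (fun h : {ffun 'I_k -> T} => h @: setT) _).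
apply/subset_leq_card/subsetP => A; rewrite inE => /and3P[AS /set0Pn[x xA] Ak].
apply/imsetP; exists [ffun i : 'I_k => nth x (enum A) i].
  apply/ffun_onP => i; rewrite ffunE; apply: (subsetP AS).
  have [h|h] := ltnP i (size (enum A)); last by rewrite nth_default.
  by rewrite -mem_enum mem_nth.
apply/setP => y; apply/idP/imsetP => [yA|[i _ ->]].
  have h : (index y (enum A) < k)%N.
    by rewrite (leq_trans _ Ak) // cardE index_mem mem_enum.
  by exists (Ordinal h) => //; rewrite ffunE nth_index ?mem_enum.
rewrite ffunE; have [h|h] := ltnP i (size (enum A)); last by rewrite nth_default.
by rewrite -mem_enum mem_nth.
Qed.

(* The direction [u] enters [e] from the relative interior of the face where
   its barycentric coordinates are negative, and [- u] from the face where
   they are positive; each of these faces determines [e], and one of them has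
   at most [uphalf d] vertices. *)
Lemma card_embedded_simplices E : (0 < d)%N -> uniform d.+1 E ->
  linearly_embeddable R d E ->
  forall S, (#|[set e in E | e \subset S]| <= 2 * #|S| ^ uphalf d)%N.
Proof.
move=> d0 uE [f finj] S.
have [|u [lam lamP]] := @generic_direction E f d0 uE.
  (* Affine independence within one simplex: with [e' = e] the common face is [e] itself, so
     comparing with [mu = 0] imposes no sign condition. *)
  move=> e eE c c0 sc fc.
  have e0 : e :&: e != set0 by rewrite setIid -card_gt0 (uE e eE).
  apply: (direction_inj finj eE eE e0 c0 (mu := fun=> 0)) => //.
  - by move=> v; rewrite setIid => /c0->.
  - by rewrite big1.
  by rewrite fc /lin_ext big1 // => v _; rewrite scale0r.
pose F (a : R) e := [set v | a * lam e v < 0].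
have Fsub a e : e \in E -> F a e \subset e.
  move=> eE; have [lam1 _ _] := lamP e eE; apply/subsetP => v.
  by rewrite inE -lam1; apply: contraTneq => ->; rewrite mulr0 ltxx.
have F0 a e : a != 0 -> e \in E -> F a e != set0.
  move=> a0 eE; have [lam1 lam2 _] := lamP e eE.
  apply: contraTneq (ltn0Sn d) => Fe; rewrite -(uE e eE) card_gt0 negbK.
  have laP v : 0 <= a * lam e v.
    by rewrite leNgt; apply/negP => h; have := in_set0 v; rewrite -Fe inE h.
  apply/eqP/setP => v; rewrite inE -lam1; apply/negbTE/negPn/eqP.
  have : \sum_v a * lam e v == 0 by rewrite -mulr_sumr lam2 mulr0.
  rewrite psumr_eq0 // => /allP/(_ v (mem_index_enum _))/=.
  by rewrite mulf_eq0 (negPf a0) => /eqP.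
(* Equal negative faces lie in [e :&: e'], so both coordinate functions are nonnegative off it and
   must agree; their support recovers the simplex. *)
have Finj a : a != 0 -> {in E &, injective (F a)}.
  move=> a0 e e' eE e'E Fee.
  have [lam1 lam2 lam3] := lamP e eE; have [mu1 mu2 mu3] := lamP e' e'E.
  have Fs : F a e \subset e :&: e' by rewrite subsetI Fsub // Fee Fsub.
  have : (fun v => a * lam e v) =1 (fun v => a * lam e' v).
    apply: (direction_inj finj eE e'E).
    - by have /set0Pn[x xF] := F0 a e a0 eE; apply/set0Pn; exists x; apply: (subsetP Fs).
    - by move=> v; rewrite -lam1 negbK => /eqP->; rewrite mulr0.
    - by move=> v; rewrite -mu1 negbK => /eqP->; rewrite mulr0.
    - by move=> v; apply: contraR; rewrite -ltNge => h; apply: (subsetP Fs); rewrite inE.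
    - move=> v; apply: contraR; rewrite -ltNge => h; apply: (subsetP Fs).
      by rewrite Fee inE.
    - by rewrite -mulr_sumr lam2 mulr0.
    - by rewrite -mulr_sumr mu2 mulr0.
    by rewrite !lin_extZ lam3 mu3.
  by move=> h; apply/setP => v; rewrite -lam1 -mu1 (mulfI a0 (h v)).
have cF e : e \in E -> (#|F 1%R e| + #|F (-1)%R e| <= d.+1)%N.
  move=> eE; rewrite -(uE e eE) -cardsUI.
  rewrite [X in (_ + #|pred_of_set X|)%N](_ : _ = set0) ?cards0 ?addn0.
    by rewrite subset_leq_card // subUset !Fsub.
  apply/setP => v; rewrite !inE mul1r mulN1r oppr_lt0.
  by apply/negP => /andP[/lt_trans h /h]; rewrite ltxx.
pose small a := [set e in E | (e \subset S) && (#|F a e| <= uphalf d)%N].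
have csmall a : a != 0 -> (#|small a| <= #|S| ^ uphalf d)%N.
  move=> a0; rewrite -(@card_in_imset _ _ (F a)); last first.
    by move=> e e'; rewrite !inE => /andP[eE _] /andP[e'E _]; apply: Finj.
  apply: leq_trans (card_small_subsets _ _).
  apply/subset_leq_card/subsetP => A /imsetP[e].
  rewrite !inE => /and3P[eE eS ce] ->; rewrite ce F0 // (subset_trans _ eS) //.
  exact: Fsub.
(* If both faces had more than [uphalf d] vertices, together they would have at least [d + 2]. *)
apply: (@leq_trans #|small 1%R :|: small (-1)%R|).
  apply/subset_leq_card/subsetP => e; rewrite !inE => /andP[eE eS].
  have := cF e eE; rewrite eE eS /= uphalf_half.
  have := odd_double_half d; rewrite -addnn; lia.
rewrite mul2n -addnn (leq_trans (leq_card_setU _ _)) // leq_add ?csmall //.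
  exact: oner_neq0.
by rewrite oppr_eq0 oner_neq0.
Qed.
End Geometry.

(** * Colorings: first moment, deletion and degeneracy *)

Section Coloring.
Variable T : finType.
Implicit Types (E : {set {set T}}) (e S B : {set T}) (c : T -> nat).
Local Open Scope nat_scope.

Definition mono c e := [forall x in e, forall y in e, c x == c y].

Lemma monoPn c e :
  reflect (exists x y, [/\ x \in e, y \in e & c x != c y]) (~~ mono c e).
Proof.
apply: (iffP forallPn) => [[x]|[x [y [xe ye cxy]]]].
  rewrite negb_imply => /andP[xe /forallPn[y]].
  by rewrite negb_imply => /andP[ye cxy]; exists x, y.
exists x; rewrite negb_imply xe; apply/forallPn; exists y.
by rewrite negb_imply ye.
Qed.

Lemma eq_mono c c' e : {in e, c =1 c'} -> mono c e = mono c' e.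
Proof.
move=> cc; apply: eq_forallb_in => x xe; apply: eq_forallb_in => y ye.
by rewrite !cc.
Qed.

(** Colors are natural numbers so that palettes can be shifted and joined. *)
Definition colorable_on E S m := exists c,
  {in S, forall v, c v < m} /\
  {in E, forall e, e \subset S -> ~~ mono c e}.

Lemma chi_le E m : {in E, forall e, 1 < #|e|} -> colorable_on E setT m ->
  chi E <= m.
Proof.
move=> E1 [c [cm cE]].
have chi_col k : k <= #|T| -> colorable E k -> chi E <= k.
  move=> kT ck; rewrite /chi -minEnat -leEnat.
  exact: (@bigmin_le_cond _ _ _ _ (Ordinal (kT : k < #|T|.+1))).
have [mT|/ltnW mT] := leqP m #|T|.
  apply: chi_col => //; apply/existsP.
  exists [ffun v => Ordinal (cm v (in_setT v))]; apply/forall_inP => e eE.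
  have /monoPn[x [y [xe ye cxy]]] := cE e eE (subsetT e).
  by apply/existsP; exists x; rewrite xe; apply/existsP; exists y; rewrite ye !ffunE.
(* Here [m] exceeds the range searched by [chi]; the injective coloring serves instead. *)
apply: leq_trans mT; apply: chi_col => //; apply/existsP.
exists [ffun v => enum_rank v]; apply/forall_inP => e eE.
have /card_gt1P[x [y [xe ye xy]]] := E1 e eE.
apply/existsP; exists x; rewrite xe; apply/existsP; exists y.
by rewrite ye !ffunE (inj_eq enum_rank_inj).
Qed.

(** A monochromatic [e] has one of [q] colors, and the vertices outside [e] are free. *)
Lemma card_mono q e : 0 < #|e| ->
  #|[set c : {ffun T -> 'I_q} | mono (fun v => c v) e]| <= q ^ (#|T| - #|e|).+1.
Proof.
move=> /card_gt0P[x xe].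
pose F (j : 'I_q) := [set c : {ffun T -> 'I_q} |
  c \in family (fun v => if v \in e then pred1 j else predT)].
have cF j : #|F j| = q ^ (#|T| - #|e|).
  rewrite cardsE card_family foldrE big_map big_enum /= (bigID (mem e)) /=.
  rewrite big1 => [|v ve]; last by rewrite ve card1.
  rewrite mul1n (eq_bigr (fun=> q)) => [|v /negPf->]; last by rewrite card_ord.
  by rewrite prod_nat_const -(cardC e) addKn.
apply: leq_trans (_ : #|\bigcup_j F j| <= _).
  apply/subset_leq_card/subsetP => c; rewrite inE => /forall_inP/(_ x xe) /forall_inP cP.
  apply/bigcupP; exists (c x) => //; rewrite inE; apply/familyP => v.
  by case: ifP => // /cP; rewrite inE eq_sym.
apply: leq_trans (_ : \sum_j #|F j| <= _).
  apply: (big_ind2 (fun (A : {set {ffun T -> 'I_q}}) m => #|A| <= m)) => //.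
    by rewrite cards0.
  move=> A m A' m' Am Am'; apply: leq_trans (leq_card_setU _ _) _.
  exact: leq_add.
by rewrite (eq_bigr _ (fun j _ => cF j)) sum_nat_const card_ord expnS.
Qed.

(* First moment method: the [q ^ #|T|] colorings have [q ^ (#|T| - d)]
   monochromatic occurrences of each edge. *)
Lemma exists_coloring_few_mono E d q : 0 < q -> uniform d.+1 E ->
  exists c : {ffun T -> 'I_q},
    #|[set e in E | mono (fun v => c v) e]| * q ^ d <= #|E|.
Proof.
move=> q0 uE; have [->|/set0Pn[e0 e0E]] := eqVneq E set0.
  exists [ffun=> Ordinal q0]; rewrite (_ : [set _ in _ | _] = set0) ?cards0 //.
  by apply/setP => e; rewrite !inE.
have dT : d < #|T| by rewrite -(uE e0 e0E) max_card.
apply/existsP; apply: contraT => /existsPn cP.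
have : \sum_(c : {ffun T -> 'I_q}) #|[set e in E | mono (fun v => c v) e]| <=
    #|E| * q ^ (#|T| - d).
  under eq_bigr do rewrite -sum1dep_card big_mkcondr.
  rewrite exchange_big /= -sum_nat_const leq_sum // => e eE.
  rewrite -big_mkcond sum1dep_card /=.
  by rewrite (leq_trans (card_mono _ _)) ?(uE e eE) // subnSK.
rewrite -(leq_pmul2r (_ : 0 < q ^ d)) ?expn_gt0 ?q0 //.
rewrite -mulnA -expnD subnK ?(ltnW dT) //.
move=> /(leq_trans _) h; have {h} := h ((#|E|.+1) * q ^ #|T|).
rewrite leq_pmul2r ?expn_gt0 ?q0 // ltnn => -> //.
rewrite big_distrl /= mulnC -[X in _ ^ X * _]/(#|T|) -[X in X ^ _]card_ord -card_ffun.
by rewrite -sum_nat_const leq_sum // => c _; rewrite ltnNge.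
Qed.

(** [B] gets the fresh colors [q + c'], so an edge inside [S] that meets both [B] and its complement
    sees two colors. *)
Lemma colorable_onU E S B q m : B \subset S ->
  colorable_on E (S :\: B) q -> colorable_on E B m -> colorable_on E S (q + m).
Proof.
move=> BS [c [cq cE]] [c' [cm cE']].
exists (fun v => if v \in B then q + c' v else c v); split.
  move=> v vS /=; case: ifP => vB; first by rewrite ltn_add2l cm.
  by rewrite ltn_addr // cq // inE vB.
move=> e eE eS; have [eB|/subsetPn[x xe xB]] := boolP (e \subset B).
  have /monoPn[x [y [xe ye cxy]]] := cE' e eE eB.
  apply/monoPn; exists x, y; split=> //.
  by rewrite !(subsetP eB) // eqn_add2l.
have [eD|] := boolP (e \subset S :\: B).
  have /monoPn[y [z [ye ze cyz]]] := cE e eE eD.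
  apply/monoPn; exists y, z; split=> //.
  have := subsetP eD y ye; have := subsetP eD z ze; rewrite !inE.
  by move=> /andP[/negPf-> _] /andP[/negPf-> _].
move=> /subsetPn[y ye]; rewrite inE (subsetP eS) // andbT negbK => yB.
apply/monoPn; exists x, y; split=> //; rewrite yB (negPf xB) neq_ltn.
have h : c x < q by apply: cq; rewrite inE xB (subsetP eS).
by rewrite (leq_trans h) // leq_addr.
Qed.

(** Deletion: [B] takes one vertex from each monochromatic edge of a coloring that has few of
    them. *)
Lemma bad_vertices E S d q : 0 < q -> uniform d.+1 E ->
  exists B, [/\ B \subset S, colorable_on E (S :\: B) q &
    #|B| * q ^ d <= #|[set e in E | e \subset S]|].
Proof.
move=> q0 uE; set ES := [set e in E | _].
have uES : uniform d.+1 ES by move=> e; rewrite inE => /andP[/uE].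
have [c cP] := exists_coloring_few_mono q0 uES.
set M := [set e in ES | _] in cP.
have Mne e : e \in M -> e != set0.
  by rewrite !inE -card_gt0 => /andP[/andP[/uE-> _] _].
have [b bP] : exists b : {set T} -> option T, forall e,
    e \in M -> exists2 x, b e = Some x & x \in e.
  exists (fun e => [pick x in e]) => e /Mne/set0Pn[x xe].
  by case: pickP => [y ye|/(_ x)]; [exists y | rewrite xe].
exists [set x in pmap b (enum M)]; split.
- apply/subsetP => x; rewrite inE mem_pmap => /mapP[e]; rewrite mem_enum => eM xe.
  have [y ye yin] := bP e eM; move: xe; rewrite ye => -[xy].
  by move: eM yin; rewrite xy !inE => /andP[/andP[_ /subsetP eS] _] /eS.
- exists (fun v => c v); split=> [v _ //|e eE eS].
  apply/negP => me; have eM : e \in M.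
    by rewrite !inE eE me (subset_trans eS) ?subsetDl.
  have [y ye yin] := bP e eM; have := subsetP eS y yin.
  by rewrite !inE mem_pmap -ye map_f ?mem_enum.
apply: leq_trans cP; rewrite leq_mul2r; apply/orP; right.
rewrite cardsE (leq_trans (card_size _)) // size_pmap (leq_trans (count_size _ _)) //.
by rewrite -cardE.
Qed.

(* Some vertex of [S] lies in at most [k * D] edges inside [S]; color it last,
   avoiding the color of one other vertex of each of these edges. *)
Lemma colorable_degenerate E k D : 1 < k -> uniform k E ->
  (forall S, #|[set e in E | e \subset S]| <= D * #|S|) ->
  forall S, colorable_on E S (k * D).+1.
Proof.
move=> k1 uE ED S; move: {2}#|S| (leqnn #|S|) => n.
elim: n S => [|n IH] S Sn.
  exists (fun=> 0); split=> // e eE eS; have := uE e eE.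
  have := subset_leq_card eS; move: Sn; lia.
have [->|/set0Pn[x0 x0S]] := eqVneq S set0.
  by apply: IH; rewrite cards0.
set ES := [set e in E | e \subset S].
(* Double counting: degrees all above [k * D] would sum to more than [k * D * #|S|], yet each of the
   at most [D * #|S|] edges is counted at most [k] times. *)
have [v vS dv] : exists2 v, v \in S & #|[set e in ES | v \in e]| <= k * D.
  apply/exists_inP; apply: contraT => /exists_inPn dP.
  have : \sum_(v in S) #|[set e in ES | v \in e]| <= k * D * #|S|.
    under eq_bigr do rewrite -sum1dep_card big_mkcondr.
    rewrite exchange_big /= -mulnA mulnC.
    apply: leq_trans (_ : \sum_(e in ES) k <= _).
      apply: leq_sum => e; rewrite inE => /andP[eE _].
      rewrite -big_mkcondr sum1dep_card -(uE e eE) subset_leq_card //.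
      by apply/subsetP => y; rewrite inE => /andP[].
    by rewrite sum_nat_const leq_mul2r ED orbT.
  rewrite leqNgt => /negP[]; rewrite mulnC -sum_nat_const.
  rewrite [X in X < _](bigD1 x0) // [X in _ < X](bigD1 x0) //=.
  rewrite -addSn leq_add //; first by rewrite ltnNge dP.
  by apply: leq_sum => y /andP[yS _]; rewrite ltnW // ltnNge dP.
have [c [cD cE]] : colorable_on E (S :\ v) (k * D).+1.
  by apply: IH; move: Sn; rewrite (cardsD1 v) vS.
(* Since [1 < k], each edge has a vertex other than [v], so the default is never reached on an
   edge. *)
pose w e := odflt v [pick x in e :\ v].
have wP e : e \in E -> w e \in e :\ v.
  rewrite /w; case: pickP => // h /uE ek; move: k1; rewrite -ek (cardsD1 v).
  by rewrite (eq_card0 h); case: (v \in e).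
pose F := [seq c (w e) | e <- enum [set e in ES | v \in e]].
have [j jD jF] : exists2 j, j < (k * D).+1 & j \notin F.
  have : ~~ all [in F] (iota 0 (k * D).+1).
    apply: contraL dv => /allP h; rewrite -ltnNge cardE -(size_map (fun e => c (w e))).
    by rewrite -[X in X <= _](size_iota 0) uniq_leq_size ?iota_uniq.
  by move=> /allPn[j]; rewrite mem_iota => /andP[_ jD] jF; exists j.
exists (fun x => if x == v then j else c x); split.
  by move=> x xS /=; case: eqP => // /eqP xv; apply: cD; rewrite !inE xv.
move=> e eE eS; have [ve|ve] := boolP (v \in e); last first.
  rewrite (eq_mono (c' := c)) ?cE ?subsetD1 ?eS // => x xe.
  by case: eqP => // xv; rewrite -xv xe in ve.
have := wP e eE; rewrite !inE => /andP[wv we].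
apply/monoPn; exists v, (w e); split=> //; rewrite eqxx (negPf wv).
apply: contraNneq jF => ->; apply/mapP; exists e => //.
by rewrite mem_enum !inE eE eS ve.
Qed.
End Coloring.

(** * Halving the bad set and summing the series *)

Section PowerBound.
Variables (R : realType) (T : finType).
Implicit Types (E : {set {set T}}) (S B : {set T}).

(* With about [4 #|S| `^ a] colors at most half of the vertices of [S] are bad;
   recoloring them with fresh colors gives a geometric series. *)
Lemma colorable_powR E d k : (0 < d)%N -> (1 < k)%N -> uniform d.+1 E ->
  (forall S, (#|[set e in E | e \subset S]| <= 2 * #|S| ^ k)%N) ->
  let a : R := (k%:R - 1) / d%:R in
  forall S, exists2 m, colorable_on E S m &
    m%:R <= 5 / (1 - 2^-1 `^ a) * #|S|%:R `^ a.
Proof.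
move=> d0 k1 uE Ek a; set K := _ / _.
have dR : (d%:R : R) != 0 by rewrite pnatr_eq0 -lt0n.
have a0 : 0 < a by rewrite divr_gt0 ?ltr0n // subr_gt0 ltr1n.
have aE : a * d%:R = k.-1%:R by rewrite divfK // -subn1 natrB // ltnW.
have oneXa : 1 `^ a = 1 :> R by rewrite powR1.
have h1 : 2^-1 `^ a < 1 :> R.
  rewrite -[ltRHS]oneXa gt0_ltr_powR ?nnegrE ?invr_ge0 //.
  by rewrite invf_lt1 ?ltr1n.
(* [K] is the solution of K = 5 + K 2^(-a): the cost of one round plus that of recoloring half of
   the vertices. *)
have KE : K * (1 - 2^-1 `^ a) = 5 by rewrite /K divfK // gt_eqF // subr_gt0.
have K0 : 0 <= K by rewrite divr_ge0 // subr_ge0 ltW.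
move=> S; move: {2}#|S| (leqnn #|S|) => n.
elim: n S => [|n IH] S Sn.
  exists 0%N; last by rewrite mulr_ge0 ?powR_ge0.
  exists (fun=> 0%N); split=> [v vS|e eE eS].
    by move: Sn; rewrite (cardD1 v) vS.
  by have := subset_leq_card eS; rewrite uE // leqNgt ltnS (leq_trans Sn).
have [->|/set0Pn[x0 x0S]] := eqVneq S set0.
  by apply: IH; rewrite cards0.
have s0 : (0 < #|S|)%N by rewrite (cardD1 x0) x0S.
set s : R := #|S|%:R.
have s1 : 1 <= s by rewrite ler1n.
have s0R : 0 <= s by rewrite (le_trans _ s1).
have sa1 : 1 <= s `^ a by rewrite -oneXa ge0_ler_powR ?nnegrE ?(ltW a0).
have /andP[q1 q2] := truncn_itv (mulr_ge0 (ler0n R 4) (powR_ge0 s a)).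
(* Thus 4 s^a < q <= 5 s^a, the rounding being absorbed by s^a >= 1. *)
set q := (Num.truncn _).+1 in q2.
have qle : q%:R <= 5 * s `^ a.
  have qE : q%:R = (Num.truncn (4 * s `^ a))%:R + 1 :> R by rewrite natr1.
  rewrite qE; lra.
have [B [BS cSB cB]] := bad_vertices S (ltn0Sn _ : (0 < q)%N) uE.
have qd : (4 * #|S| ^ k.-1 <= q ^ d)%N.
  rewrite -(ler_nat R) natrX natrM natrX.
  apply: le_trans (_ : (4 * s `^ a) ^+ d <= _); last first.
    by rewrite lerXn2r ?nnegrE ?(ltW q2) // mulr_ge0 ?powR_ge0.
  rewrite exprMn -(powR_mulrn d (powR_ge0 _ _)) -powRrM aE powR_mulrn //.
  rewrite ler_wpM2r ?exprn_ge0 //.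
  by rewrite -natrX ler_nat -{1}(expn1 4) leq_exp2l.
(* Cancel [2 * #|S| ^ k.-1] in [#|B| * (4 * #|S| ^ k.-1) <= #|B| * q ^ d <= 2 * #|S| ^ k]. *)
have B2 : (#|B| * 2 <= #|S|)%N.
  have := leq_trans (leq_mul (leqnn #|B|) qd) (leq_trans cB (Ek S)).
  rewrite -{2}(ltn_predK k1) expnS => h.
  rewrite -(@leq_pmul2r (#|S| ^ k.-1)) ?expn_gt0 ?s0 // -(@leq_pmul2l 2) //.
  by move: h; congr (_ <= _)%N; lia.
have [|m cm mle] := IH B; first by move: B2 Sn s0; lia.
exists (q + m)%N; first exact: colorable_onU cSB cm.
have Ba : #|B|%:R `^ a <= s `^ a * 2^-1 `^ a.
  rewrite -powRM // ?invr_ge0 //; apply: ge0_ler_powR; rewrite ?nnegrE ?(ltW a0) //.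
    by rewrite divr_ge0.
  by rewrite ler_pdivlMr // -natrM ler_nat.
rewrite natrD (le_trans (lerD qle mle)) //.
rewrite (le_trans (lerD (lexx _) (ler_wpM2l K0 Ba))) //.
by rewrite -KE; lra.
Qed.
End PowerBound.

Theorem theorem6p1 (R : realType) (d : nat) (hd : (0 < d)%N) :
  exists C : R,
    forall (T : finType) (E : {set {set T}}),
      uniform d.+1 E ->
      (forall v : T, exists2 e, e \in E & v \in e) ->
      (0 < #|T|)%N ->
      linearly_embeddable R d E ->
      (chi E)%:R <= C * (#|T|%:R `^ (((uphalf d)%:R - 1) / d%:R)).
Proof.
have E1 (T : finType) (E : {set {set T}}) : uniform d.+1 E ->
  {in E, forall e : {set T}, (1 < #|e|)%N} by move=> uE e /uE->.
(* For d <= 2 the exponent is 0 and 1 - 2^(-a) vanishes, so the series diverges; but edges are then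
   linear in number, and degeneracy gives a constant bound. *)
have [k1|k1] := leqP (uphalf d) 1.
  have k_eq : uphalf d = 1%N by apply/eqP; rewrite eqn_leq k1 uphalf_gt0.
  exists (d.+1 * 2).+1%:R => T E uE _ _ emb.
  rewrite k_eq subrr mul0r powRr0 mulr1 ler_nat.
  apply: chi_le (E1 _ _ uE) _; apply: colorable_degenerate => // S.
  by have := card_embedded_simplices hd uE emb S; rewrite k_eq expn1.
exists (5 / (1 - 2^-1 `^ (((uphalf d)%:R - 1) / d%:R))) => T E uE _ _ emb.
have [m cm mle] :=
  colorable_powR R hd k1 uE (card_embedded_simplices hd uE emb) setT.
rewrite -cardsT (le_trans _ mle) // ler_nat.
exact: chi_le (E1 _ _ uE) cm.
Qed.
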